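(* Let $T=\{1342,2134,2413\}$. Then $$F_T(x)=\frac{(1-x)(1-2x)(1-3x)}{1-7x+16x^2-14x^3+3x^4}.$$
   Context: $S_n(T)$ denotes the set of permutations $\pi$ of $[n]=\{1,\dots,n\}$ (one-line notation) that avoid every pattern $\tau\in T$, i.e. no subsequence of $\pi$ is order-isomorphic to $\tau$. $F_T(x)=\sum_{n\ge 0}|S_n(T)|x^n$, a formal power series, with $|S_0(T)|=1$. *)

(* Defs.v *)
From mathcomp Require Import all_boot all_order all_fingroup all_algebra.

Set Implicit Arguments.
Unset Strict Implicit.
Unset Printing Implicit Defensive.

Import GRing.Theory.

Definition order_iso (s t : seq nat) : bool :=
  (size s == size t) &&
  [forall i : 'I_(size s), forall j : 'I_(size s),
     (nth 0 s i < nth 0 s j) == (nth 0 t i < nth 0 t j)].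

(* The masks of w select exactly the (not necessarily contiguous)
   subsequences of w; see containsP. *)
Definition contains (w tau : seq nat) : bool :=
  [exists m : (size w).-tuple bool, order_iso (mask m w) tau].

Lemma containsP (w tau : seq nat) :
  reflect (exists2 u, subseq u w & order_iso u tau) (contains w tau).
Proof.
apply: (iffP existsP) => [[m m_iso]|[u /subseqP[m sz_m ->] u_iso]].
  by exists (mask m w) => //; apply: mask_subseq.
by exists (Tuple (introT eqP sz_m)).
Qed.

(* 'S_n permutes {0, ..., n-1}; the shift makes the values range over [n]. *)
Definition one_line (n : nat) (s : 'S_n) : seq nat :=
  [seq (s i).+1 | i <- enum 'I_n].

Definition avoiders (T : seq (seq nat)) (n : nat) : {set 'S_n} :=
  [set s | all (fun tau => ~~ contains (one_line s) tau) T].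

Local Open Scope ring_scope.

(* A formal power series is its sequence of coefficients, and two series are
   equal when they agree coefficientwise. *)
Definition fps (R : Type) : Type := nat -> R.

Definition fps_mul (R : pzRingType) (f g : fps R) : fps R :=
  fun n => \sum_(i < n.+1) f i * g (n - i)%N.

Definition fps_of_poly (R : nzRingType) (p : {poly R}) : fps R :=
  fun n => p`_n.

(* [:: g 0; ...; g n] for the inverse g of f, obtained by solving f * g = 1
   degree by degree. *)
Fixpoint fps_inv_prefix (K : fieldType) (f : fps K) (n : nat) : seq K :=
  if n is m.+1 then
    let s := fps_inv_prefix f m in
    rcons s (- (f 0%N)^-1 * \sum_(i < m.+1) f i.+1 * s`_(m - i))
  else [:: (f 0%N)^-1].

Definition fps_inv (K : fieldType) (f : fps K) : fps K :=
  fun n => (fps_inv_prefix f n)`_n.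

Definition fps_div (K : fieldType) (f g : fps K) : fps K :=
  fps_mul f (fps_inv g).

Lemma size_fps_inv_prefix (K : fieldType) (f : fps K) n :
  size (fps_inv_prefix f n) = n.+1.
Proof. by elim: n => //= n IHn; rewrite size_rcons IHn. Qed.

Lemma nth_fps_inv_prefix (K : fieldType) (f : fps K) n i :
  (i <= n)%N -> (fps_inv_prefix f n)`_i = fps_inv f i.
Proof.
elim: n => [|n IHn]; first by case: i.
rewrite leq_eqVlt => /predU1P[-> //|le_in] /=.
by rewrite nth_rcons size_fps_inv_prefix le_in IHn.
Qed.

Lemma fps_mul_inv (K : fieldType) (f : fps K) :
  f 0%N != 0 -> fps_mul f (fps_inv f) =1 fps_of_poly 1.
Proof.
move=> f0 [|n]; rewrite /fps_mul /fps_of_poly coef1 big_ord_recl /=.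
  by rewrite big_ord0 addr0 /fps_inv /= mulfV.
rewrite subn0 {1}/fps_inv /= nth_rcons size_fps_inv_prefix ltnn eqxx.
rewrite mulNr mulrN mulVKf // addrC; apply/eqP; rewrite subr_eq0; apply/eqP.
apply: eq_bigr => i _; rewrite /bump /= add1n subSS.
by rewrite nth_fps_inv_prefix // leq_subr.
Qed.

Definition avoid_gf (T : seq (seq nat)) : fps rat :=
  fun n => #|avoiders T n|%:R.

(* Main.v *)
(* Write a T-avoider as w = a t, with L the letters below a and B those above.
   The word starts with a B0, where B0 consists of letters above a. If the rest
   contains no letter above a, then w = a B0 L, where B0 avoids {231, 2134} and
   L avoids T, and these are the only constraints. Otherwise w = a B0 L' B1 L''
   with L' and B1 nonempty, B0 < B1 and B1 decreasing; here B0 avoids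
   {213, 231}, and contracting B1 to a single letter N leaves an arbitrary
   T-avoider L' N L'' whose maximum N is not in first position. Since the
   T-avoiders of size k+1 starting with their maximum are as many as the
   T-avoiders of size k, this gives, with P the series of {231, 2134},
     F = 1 + x P F + (x/(1-2x)) (F - 1 - x F),
   where x/(1-2x) counts the pairs (B0, B1). Splitting at the first letter
   also gives (1-2x) P = 1 - x + x (x/(1-2x) - x/(1-x)). *)
Require Import Defs.
From mathcomp Require Import all_boot all_order all_fingroup all_algebra.
From mathcomp Require Import zify ring.

Set Implicit Arguments.
Unset Strict Implicit.
Unset Printing Implicit Defensive.

(** * Avoidance for words on an interval of letters *)

Definition avoids (T : seq (seq nat)) (w : seq nat) : bool :=
  all (fun tau => ~~ contains w tau) T.

Arguments avoids : simpl never.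

(** The offset [lo] lets the blocks of a decomposed word be counted in place, without renaming their
    letters. *)
Definition avoiding_words (T : seq (seq nat)) (lo n : nat) : seq (seq nat) :=
  [seq w <- permutations (iota lo n) | avoids T w].

Definition num_avoiding (T : seq (seq nat)) (n : nat) : nat :=
  size (avoiding_words T 0 n).

Lemma order_isoP s t :
  reflect (size s = size t /\
           forall i j, i < size s -> j < size s ->
             (nth 0 s i < nth 0 s j) = (nth 0 t i < nth 0 t j))
          (order_iso s t).
Proof.
apply: (iffP andP) => [[/eqP eq_sz /forallP iso]|[-> iso]]; split=> //.
  move=> i j lt_i lt_j.
  by have /forallP/(_ (Ordinal lt_j))/eqP := iso (Ordinal lt_i).
by apply/forallP=> i; apply/forallP=> j; apply/eqP/iso.
Qed.

Lemma order_iso_map f s t :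
  {in s &, forall x y, (f x < f y) = (x < y)} ->
  order_iso (map f s) t = order_iso s t.
Proof.
move=> f_mono; apply/order_isoP/order_isoP; rewrite size_map => -[eq_sz iso];
  split=> // i j lt_i lt_j; move: (iso i j lt_i lt_j);
  by rewrite !(nth_map 0) // f_mono ?mem_nth.
Qed.

Lemma contains_map f w tau :
  {in w &, forall x y, (f x < f y) = (x < y)} ->
  contains (map f w) tau = contains w tau.
Proof.
move=> f_mono; apply/containsP/containsP => -[u sub_u iso_u].
  have /subseqP[m sz_m def_u] := sub_u.
  exists (mask m w); first exact: mask_subseq.
  rewrite def_u -map_mask order_iso_map // in iso_u.
  by move=> x y /mem_mask x_w /mem_mask y_w; apply: f_mono.
exists (map f u); first exact: map_subseq.
by rewrite order_iso_map // => x y /(mem_subseq sub_u) x_w /(mem_subseq sub_u);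
  apply: f_mono.
Qed.

Lemma avoids_map T f w :
  {in w &, forall x y, (f x < f y) = (x < y)} ->
  avoids T (map f w) = avoids T w.
Proof. by move=> f_mono; apply: eq_all => tau; rewrite contains_map. Qed.

Lemma avoids_subseq T u w : subseq u w -> avoids T w -> avoids T u.
Proof.
move=> sub_uw /allP w_av; apply/allP=> tau /w_av; apply: contra.
by case/containsP=> v sub_v iso_v; apply/containsP; exists v => //;
  apply: subseq_trans sub_uw.
Qed.

Lemma mem_avoiding_words T lo n w :
  (w \in avoiding_words T lo n) = perm_eq w (iota lo n) && avoids T w.
Proof. by rewrite mem_filter mem_permutations andbC. Qed.

Lemma avoiding_words_uniq T lo n : uniq (avoiding_words T lo n).
Proof. exact/filter_uniq/permutations_uniq. Qed.

Lemma size_avoiding_words T lo n :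
  size (avoiding_words T lo n) = num_avoiding T n.
Proof.
rewrite -[RHS](size_map (map (addn lo))); apply/perm_size/uniq_perm.
- exact: avoiding_words_uniq.
- by rewrite map_inj_uniq ?avoiding_words_uniq //; apply/inj_map/addnI.
move=> w; rewrite mem_avoiding_words; apply/idP/mapP => [/andP[w_perm w_av]|].
  exists (map (subn^~ lo) w); last first.
    rewrite -map_comp map_id_in // => x; rewrite (perm_mem w_perm) mem_iota /=.
    by move=> ?; lia.
  rewrite mem_avoiding_words avoids_map ?w_av ?andbT; last first.
    by move=> x y; rewrite !(perm_mem w_perm) !mem_iota => ? ?; lia.
  have -> : iota 0 n = map (subn^~ lo) (iota lo n).
    rewrite -[in iota lo _](addn0 lo) iotaDl -map_comp map_id_in // => x _ /=.
    exact: addKn.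
  exact: perm_map.
case=> v; rewrite mem_avoiding_words => /andP[v_perm v_av] ->.
rewrite avoids_map ?v_av ?andbT => [|x y _ _]; last by rewrite ltn_add2l.
by rewrite -[in iota lo _](addn0 lo) iotaDl perm_map.
Qed.

(** One-line words are pairwise distinct members of [permutations (iota 1 n)], and both lists have
    [n!] entries, so they agree up to order. From here on only words are counted. *)
Lemma card_avoiders T n : #|avoiders T n| = num_avoiding T n.
Proof.
have one_line_inj : injective (@one_line n).
  move=> s t eq_st; apply/permP=> i.
  have /eq_in_map/(_ i) := eq_st; rewrite mem_enum => /(_ isT)[].
  exact: val_inj.
have enum_words :
    perm_eq [seq one_line s | s <- enum 'S_n] (permutations (iota 1 n)).
  have map_uniq : uniq [seq one_line s | s <- enum 'S_n].
    by rewrite map_inj_uniq ?enum_uniq.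
  have words_sub : {subset [seq one_line s | s <- enum 'S_n]
                      <= permutations (iota 1 n)}.
    move=> _ /mapP[s _ ->]; rewrite mem_permutations uniq_perm ?iota_uniq //.
      by rewrite map_inj_uniq ?enum_uniq // => i j [/val_inj/perm_inj].
    move=> x; rewrite mem_iota; apply/mapP/idP => [[i _ ->]|lt_x].
      by have := ltn_ord (s i); lia.
    have lt_x1 : x.-1 < n by lia.
    exists ((s^-1)%g (Ordinal lt_x1)); first by rewrite mem_enum.
    by rewrite permKV /=; lia.
  rewrite uniq_perm ?permutations_uniq //.
  have [|//] := uniq_min_size map_uniq words_sub.
  rewrite size_permutations ?iota_uniq // size_iota size_map -cardE.
  by rewrite card_Sn.
rewrite -(size_avoiding_words T 1 n) cardE -(size_map (@one_line n)).
rewrite /avoiding_words -(perm_size (perm_filter (avoids T) enum_words)).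
rewrite filter_map !size_map /enum_mem -filter_predI; congr size.
apply: eq_filter => s /=.
by rewrite inE andbT.
Qed.

(** * Occurrences of short patterns, and how they meet a concatenation *)

Lemma subseq_catP (s u v : seq nat) :
  subseq s (u ++ v) ->
  exists s1 s2, [/\ s = s1 ++ s2, subseq s1 u & subseq s2 v].
Proof.
case/subseqP=> m sz_m ->; rewrite -(cat_take_drop (size u) m) mask_cat; last first.
  by rewrite size_takel // sz_m size_cat leq_addr.
by exists (mask (take (size u) m) u), (mask (drop (size u) m) v);
  split; rewrite ?mask_subseq.
Qed.

Lemma contains4 w t1 t2 t3 t4 :
  reflect (exists a b c d, subseq [:: a; b; c; d] w /\
                           order_iso [:: a; b; c; d] [:: t1; t2; t3; t4])
          (contains w [:: t1; t2; t3; t4]).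
Proof.
apply: (iffP (containsP _ _)) => [[u sub_u iso_u]|[a [b [c [d [? ?]]]]]]; last first.
  by exists [:: a; b; c; d].
have /order_isoP[] := iso_u.
by case: u sub_u iso_u => [|a [|b [|c [|d []]]]] // *; exists a, b, c, d.
Qed.

Lemma contains3 w t1 t2 t3 :
  reflect (exists a b c, subseq [:: a; b; c] w /\
                         order_iso [:: a; b; c] [:: t1; t2; t3])
          (contains w [:: t1; t2; t3]).
Proof.
apply: (iffP (containsP _ _)) => [[u sub_u iso_u]|[a [b [c [? ?]]]]]; last first.
  by exists [:: a; b; c].
have /order_isoP[] := iso_u.
by case: u sub_u iso_u => [|a [|b [|c []]]] // *; exists a, b, c.
Qed.

Ltac order_iso_tac :=
  apply/order_isoP/idP => [[_ iso]|?];
  [ have := iso 0 1; have := iso 0 2; have := iso 0 3;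
    have := iso 1 2; have := iso 1 3; have := iso 2 3;
    have := iso 1 0; have := iso 2 0; have := iso 3 0;
    have := iso 2 1; have := iso 3 1; have := iso 3 2; rewrite /=; lia
  | split=> //; case=> [|[|[|[|i]]]] // [|[|[|[|j]]]] //= _ _; lia].

Lemma order_iso_1342 a b c d :
  order_iso [:: a; b; c; d] [:: 1; 3; 4; 2] = (a < d < b) && (b < c).
Proof. order_iso_tac. Qed.

Lemma order_iso_2134 a b c d :
  order_iso [:: a; b; c; d] [:: 2; 1; 3; 4] = (b < a < c) && (c < d).
Proof. order_iso_tac. Qed.

Lemma order_iso_2413 a b c d :
  order_iso [:: a; b; c; d] [:: 2; 4; 1; 3] = (c < a < d) && (d < b).
Proof. order_iso_tac. Qed.

Lemma order_iso_213 a b c :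
  order_iso [:: a; b; c] [:: 2; 1; 3] = (b < a < c).
Proof. order_iso_tac. Qed.

Lemma order_iso_231 a b c :
  order_iso [:: a; b; c] [:: 2; 3; 1] = (c < a < b).
Proof. order_iso_tac. Qed.

Local Notation T24 := [:: [:: 1; 3; 4; 2]; [:: 2; 1; 3; 4]; [:: 2; 4; 1; 3]].
(** [P24] governs the block B0 when no letter above the first one comes after it, [Q24] when some
    such letter does. *)
Local Notation P24 := [:: [:: 2; 3; 1]; [:: 2; 1; 3; 4]].
Local Notation Q24 := [:: [:: 2; 1; 3]; [:: 2; 3; 1]].

Lemma avoids_T24P w :
  reflect (forall a b c d, subseq [:: a; b; c; d] w ->
             [&& ~~ ((a < d < b) && (b < c)), ~~ ((b < a < c) && (c < d))
               & ~~ ((c < a < d) && (d < b))])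
          (avoids T24 w).
Proof.
rewrite /avoids /= andbT.
apply: (iffP and3P) => [[/contains4 no1342 no2134 no2413]|free].
  move=> a b c d sub_w; apply/and3P; split.
  - by rewrite -order_iso_1342; apply/negP=> ?; apply: no1342; exists a, b, c, d.
  - rewrite -order_iso_2134; apply/negP=> ?; case/contains4: no2134.
    by exists a, b, c, d.
  rewrite -order_iso_2413; apply/negP=> ?; case/contains4: no2413.
  by exists a, b, c, d.
split; apply/contains4=> -[a [b [c [d [/free/and3P[? ? ?]]]]]].
- by rewrite order_iso_1342; apply/negP.
- by rewrite order_iso_2134; apply/negP.
by rewrite order_iso_2413; apply/negP.
Qed.

Lemma avoids_P24P w :
  reflect ((forall a b c, subseq [:: a; b; c] w -> ~~ (c < a < b)) /\
           forall a b c d, subseq [:: a; b; c; d] w -> ~~ ((b < a < c) && (c < d)))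
          (avoids P24 w).
Proof.
rewrite /avoids /= andbT; apply: (iffP andP) => -[no231 no2134]; split.
- move=> a b c sub_w; rewrite -order_iso_231; apply/negP=> ?.
  by case/contains3: no231; exists a, b, c.
- move=> a b c d sub_w; rewrite -order_iso_2134; apply/negP=> ?.
  by case/contains4: no2134; exists a, b, c, d.
- apply/contains3=> -[a [b [c [/no231]]]].
  by rewrite order_iso_231; apply/negP.
apply/contains4=> -[a [b [c [d [/no2134]]]]].
by rewrite order_iso_2134; apply/negP.
Qed.

Lemma avoids_Q24P w :
  reflect (forall a b c, subseq [:: a; b; c] w ->
             ~~ (b < a < c) && ~~ (c < a < b))
          (avoids Q24 w).
Proof.
rewrite /avoids /= andbT; apply: (iffP andP) => [[no213 no231]|free].
  move=> a b c sub_w; rewrite -(order_iso_231 a b c) -(order_iso_213 a b c).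
  apply/andP; split; apply/negP=> ?.
    by case/contains3: no213; exists a, b, c.
  by case/contains3: no231; exists a, b, c.
split; apply/contains3=> -[a [b [c [/free/andP[? ?]]]]].
  by rewrite order_iso_213; apply/negP.
by rewrite order_iso_231; apply/negP.
Qed.

Lemma subseq_consP (x y : nat) s u :
  subseq (x :: s) (y :: u) -> (x = y /\ subseq s u) \/ subseq (x :: s) u.
Proof. by rewrite /=; case: eqP => [->|_]; [left | right]. Qed.

Lemma subseq_234 (a b c d : nat) w :
  subseq [:: a; b; c; d] w -> subseq [:: b; c; d] w.
Proof.
exact/subseq_trans/(mask_subseq [:: false; true; true; true] [:: a; b; c; d]).
Qed.

Lemma subseq_123 (a b c d : nat) w :
  subseq [:: a; b; c; d] w -> subseq [:: a; b; c] w.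
Proof.
exact/subseq_trans/(mask_subseq [:: true; true; true; false] [:: a; b; c; d]).
Qed.

Lemma subseq_23 (a b c : nat) w : subseq [:: a; b; c] w -> subseq [:: b; c] w.
Proof.
exact/subseq_trans/(mask_subseq [:: false; true; true] [:: a; b; c]).
Qed.

Lemma subseq_12 (a b c : nat) w : subseq [:: a; b; c] w -> subseq [:: a; b] w.
Proof.
exact/subseq_trans/(mask_subseq [:: true; true; false] [:: a; b; c]).
Qed.

Lemma mem_subseq1 (a : nat) s w : subseq (a :: s) w -> a \in w.
Proof. by move/mem_subseq; apply; apply: mem_head. Qed.

Lemma subseq_behead (a : nat) s w : subseq (a :: s) w -> subseq s w.
Proof. exact/subseq_trans/subseq_cons. Qed.

(** The index of a constructor is the number of letters of the occurrence that fall in [u]. *)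
Variant split3 (a b c : nat) u v : Prop :=
  | Split3_0 of subseq [:: a; b; c] v
  | Split3_1 of a \in u & subseq [:: b; c] v
  | Split3_2 of subseq [:: a; b] u & c \in v
  | Split3_3 of subseq [:: a; b; c] u.

Variant split4 (a b c d : nat) u v : Prop :=
  | Split4_0 of subseq [:: a; b; c; d] v
  | Split4_1 of a \in u & subseq [:: b; c; d] v
  | Split4_2 of subseq [:: a; b] u & subseq [:: c; d] v
  | Split4_3 of subseq [:: a; b; c] u & d \in v
  | Split4_4 of subseq [:: a; b; c; d] u.

Lemma subseq3_catP a b c u v : subseq [:: a; b; c] (u ++ v) -> split3 a b c u v.
Proof.
case/subseq_catP=> s1 [s2 [+ + +]].
by case: s1 => [|x1 [|x2 [|x3 [|]]]] //= [*]; subst;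
  [constructor 1 | constructor 2; rewrite -?sub1seq
  | constructor 3; rewrite -?sub1seq | constructor 4].
Qed.

Lemma subseq4_catP a b c d u v :
  subseq [:: a; b; c; d] (u ++ v) -> split4 a b c d u v.
Proof.
case/subseq_catP=> s1 [s2 [+ + +]].
by case: s1 => [|x1 [|x2 [|x3 [|x4 [|]]]]] //= [*]; subst;
  [constructor 1 | constructor 2; rewrite -?sub1seq
  | constructor 3 | constructor 4; rewrite -?sub1seq | constructor 5].
Qed.

Lemma mem_subseq2 (a b : nat) w : subseq [:: a; b] w -> a \in w /\ b \in w.
Proof. by move=> Hw; have := mem_subseq1 (subseq_behead Hw); have := mem_subseq1 Hw. Qed.

Lemma mem_subseq3 (a b c : nat) w :
  subseq [:: a; b; c] w -> [/\ a \in w, b \in w & c \in w].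
Proof. by move=> Hw; have [? ?] := mem_subseq2 (subseq_behead Hw); have := mem_subseq1 Hw. Qed.

(** * Avoidance of words built from blocks *)

(** None of the three patterns has a proper prefix lying above the rest of it, so an occurrence
    cannot straddle the cut. *)
Lemma avoids_T24_skew u v :
  {in u & v, forall x y, y < x} ->
  avoids T24 (u ++ v) = avoids T24 u && avoids T24 v.
Proof.
move=> lt_vu; apply/idP/andP => [uv_av|[/avoids_T24P u_av /avoids_T24P v_av]].
  by split; apply: avoids_subseq uv_av; rewrite ?prefix_subseq ?suffix_subseq.
apply/avoids_T24P => a b c d /subseq4_catP[].
- exact: v_av.
- move=> a_u /mem_subseq3[b_v c_v d_v].
  have := lt_vu _ _ a_u b_v; have := lt_vu _ _ a_u c_v.
  have := lt_vu _ _ a_u d_v; lia.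
- move=> /mem_subseq2[a_u b_u] /mem_subseq2[c_v d_v].
  have := lt_vu _ _ a_u c_v; have := lt_vu _ _ a_u d_v.
  have := lt_vu _ _ b_u c_v; have := lt_vu _ _ b_u d_v; lia.
- move=> /mem_subseq3[a_u b_u c_u] d_v.
  have := lt_vu _ _ a_u d_v; have := lt_vu _ _ b_u d_v.
  have := lt_vu _ _ c_u d_v; lia.
exact: u_av.
Qed.

(** Neither 231 nor 2134 starts with its smallest or with its largest letter, so an extreme first
    letter takes part in no occurrence. The same holds of 213 and 231 below. *)
Lemma avoids_P24_min c w :
  {in w, forall x, c < x} -> avoids P24 (c :: w) = avoids P24 w.
Proof.
move=> lt_cw; apply/idP/idP => [|/avoids_P24P[no231 no2134]].
  exact/avoids_subseq/subseq_cons.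
apply/avoids_P24P; split=> [x y z|x y z t] /subseq_consP[[-> Hw]|]; auto.
  have [/lt_cw ? /lt_cw ?] := mem_subseq2 Hw; lia.
have [/lt_cw ? /lt_cw ? /lt_cw ?] := mem_subseq3 Hw; lia.
Qed.

Lemma avoids_P24_max c w :
  {in w, forall x, x < c} -> avoids P24 (c :: w) = avoids P24 w.
Proof.
move=> lt_wc; apply/idP/idP => [|/avoids_P24P[no231 no2134]].
  exact/avoids_subseq/subseq_cons.
apply/avoids_P24P; split=> [x y z|x y z t] /subseq_consP[[-> Hw]|]; auto.
  have [/lt_wc ? /lt_wc ?] := mem_subseq2 Hw; lia.
have [/lt_wc ? /lt_wc ? /lt_wc ?] := mem_subseq3 Hw; lia.
Qed.

Lemma avoids_Q24_min c w :
  {in w, forall x, c < x} -> avoids Q24 (c :: w) = avoids Q24 w.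
Proof.
move=> lt_cw; apply/idP/idP => [|/avoids_Q24P no3].
  exact/avoids_subseq/subseq_cons.
apply/avoids_Q24P => x y z /subseq_consP[[-> Hw]|]; auto.
have [/lt_cw ? /lt_cw ?] := mem_subseq2 Hw; lia.
Qed.

Lemma avoids_Q24_max c w :
  {in w, forall x, x < c} -> avoids Q24 (c :: w) = avoids Q24 w.
Proof.
move=> lt_wc; apply/idP/idP => [|/avoids_Q24P no3].
  exact/avoids_subseq/subseq_cons.
apply/avoids_Q24P => x y z /subseq_consP[[-> Hw]|]; auto.
have [/lt_wc ? /lt_wc ?] := mem_subseq2 Hw; lia.
Qed.

Lemma avoids_Q24_P24 w : avoids Q24 w -> avoids P24 w.
Proof.
move/avoids_Q24P=> no3; apply/avoids_P24P; split=> [a b c|a b c d] Hw.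
  by case/andP: (no3 _ _ _ Hw).
have := no3 _ _ _ (subseq_123 Hw); lia.
Qed.

(** With [c] in front, a 231 in [w] becomes a 1342. Conversely 1342 and 2413 both contain 231, as
    their last and first three letters, so excluding 231 excludes both. *)
Lemma avoids_T24_min c w :
  {in w, forall x, c < x} -> avoids T24 (c :: w) = avoids P24 w.
Proof.
move=> lt_cw; apply/avoids_T24P/avoids_P24P => [free|[no231 no2134] x y z t].
  split=> [x y z|x y z t] Hw; last first.
    by case/and3P: (free x y z t (subseq_trans Hw (subseq_cons w c))).
  have [/lt_cw ? /lt_cw ? /lt_cw ?] := mem_subseq3 Hw.
  have := free c x y z; rewrite /= eqxx => /(_ Hw); lia.
case/subseq_consP=> [[-> Hw]|Hw].
  have [/lt_cw ? /lt_cw ? /lt_cw ?] := mem_subseq3 Hw.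
  have := no231 _ _ _ Hw; lia.
have := no231 _ _ _ (subseq_234 Hw); have := no231 _ _ _ (subseq_123 Hw).
have := no2134 _ _ _ _ Hw; lia.
Qed.

Lemma sorted_gtnP (w : seq nat) :
  reflect (forall x y, subseq [:: x; y] w -> y < x) (sorted gtn w).
Proof.
apply: (iffP idP) => [w_dec x y /subseq_sorted|].
  have gtn_trans : transitive gtn by move=> ? ? ?; rewrite /=; lia.
  by move/(_ gtn gtn_trans w_dec); rewrite /= andbT.
elim: w => [|x [|y w] IHw] //= w_dec.
rewrite w_dec ?eqxx ?sub0seq //=; apply: IHw => u v Huv.
by apply: w_dec; apply: subseq_trans Huv (subseq_cons _ _).
Qed.

(** A letter of [v] completes a 213 in [u] to a 2134, and [c], a letter of [u] and an ascent in [v]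
    form a 2134. Conversely [c :: u] has no 213 and lies below the decreasing [v], so nothing
    straddles the cut. *)
Lemma avoids_P24_split c (u v : seq nat) :
    {in u, forall x, x < c} -> {in v, forall x, c < x} ->
    uniq v -> u != [::] -> v != [::] ->
  avoids P24 (c :: u ++ v) = avoids Q24 u && sorted gtn v.
Proof.
move=> lt_uc lt_cv v_uniq u_n0 v_n0; apply/idP/andP => [|[]].
  case/avoids_P24P=> no231 no2134; split.
    case: v v_n0 lt_cv v_uniq no231 no2134 => // t v _ lt_cv _ no231 no2134.
    apply/avoids_Q24P => x y z Hu; apply/andP; split; last first.
      apply: no231; apply: subseq_trans (subseq_cons _ _).
      exact: subseq_trans Hu (prefix_subseq _ _).
    have Huv : subseq [:: x; y; z; t] (c :: u ++ t :: v).
      apply: subseq_trans (subseq_cons _ _).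
      rewrite -[[:: x; y; z; t]]/([:: x; y; z] ++ [:: t]) cat_subseq //.
      by rewrite sub1seq mem_head.
    have [_ _ /lt_uc ?] := mem_subseq3 Hu.
    have /lt_cv ? := mem_head t v; have := no2134 _ _ _ _ Huv; lia.
  case: u u_n0 lt_uc no231 no2134 => // s u _ lt_uc no231 no2134.
  apply/sorted_gtnP=> x y Hv.
  have Huv : subseq [:: c; s; x; y] (c :: (s :: u) ++ v).
    by rewrite /= !eqxx; apply: subseq_trans Hv (suffix_subseq _ _).
  have [/lt_cv ? /lt_cv ?] := mem_subseq2 Hv.
  have /lt_uc ? := mem_head s u.
  have : x != y by have := subseq_uniq Hv v_uniq; rewrite /= inE andbT.
  have := no2134 _ _ _ _ Huv; lia.
move=> u_av /sorted_gtnP v_dec.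
have /avoids_P24P[no231 no2134] : avoids P24 (c :: u).
  by rewrite avoids_P24_max // avoids_Q24_P24.
have cu_no213 x y z : subseq [:: x; y; z] (c :: u) -> ~~ (y < x < z).
  case/subseq_consP=> [[-> /mem_subseq2[/lt_uc ? /lt_uc ?]]|Hu]; first lia.
  by move/avoids_Q24P: u_av => /(_ _ _ _ Hu)/andP[].
have lt_cuv x y : x \in c :: u -> y \in v -> x < y.
  by rewrite inE => /predU1P[->|/lt_uc ?] /lt_cv ?; lia.
rewrite -cat_cons; apply/avoids_P24P; split=> [x y z|x y z t].
  case/subseq3_catP => [Hv|x_u Hv|Hu z_v|]; last exact: no231.
  - by have := v_dec _ _ (subseq_12 Hv); lia.
  - by have [y_v /(lt_cuv _ _ x_u) ?] := mem_subseq2 Hv; lia.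
  by have [/lt_cuv/(_ z_v) ? _] := mem_subseq2 Hu; lia.
case/subseq4_catP => [Hv|x_u Hv|Hu Hv|Hu z_v|]; last exact: no2134.
- by have := v_dec _ _ (subseq_23 (subseq_234 Hv)); lia.
- by have := v_dec _ _ (subseq_23 Hv); lia.
- by have := v_dec _ _ Hv; lia.
by have := cu_no213 _ _ _ Hu; lia.
Qed.

(** A letter above all others matters only through its position: replacing [m] by [n] preserves the
    order. *)
Lemma avoids_map_marker T m n (u v : seq nat) :
    {in u ++ v, forall x, x < m} -> {in u ++ v, forall x, x < n} ->
  avoids T (u ++ m :: v) = avoids T (u ++ n :: v).
Proof.
move=> lt_m lt_n; pose f x := if x == m then n else x.
have f_id w : {subset w <= u ++ v} -> map f w = w.
  move=> sub_w; rewrite map_id_in // => x /sub_w/lt_m lt_xm; rewrite /f ifN //; lia.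
have <- : map f (u ++ m :: v) = u ++ n :: v.
  rewrite map_cat /= {2}/f eqxx !f_id // => x; rewrite mem_cat => ->;
  by rewrite ?orbT.
rewrite avoids_map // => x y.
have cases z : z \in u ++ m :: v ->
    (z = m /\ f z = n) \/ (z < m /\ z < n /\ f z = z).
  rewrite mem_cat inE orbCA -mem_cat => /predU1P[->|z_uv].
    by left; rewrite /f eqxx.
  have := lt_m _ z_uv; have := lt_n _ z_uv; right; rewrite /f; case: eqP; lia.
by move=> /cases ? /cases ?; lia.
Qed.

(** An occurrence with at most one letter in the block already exists when the block is shrunk to
    that letter. With two or more, the pattern would have a contiguous decreasing run above all its
    other letters, which none of 1342, 2134, 2413 has. *)
Lemma avoids_T24_inflate a (u v : seq nat) x w :
    {in u ++ v, forall z, z < a} -> {in x :: w, forall z, a < z} ->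
    sorted gtn (x :: w) ->
  avoids T24 (u ++ (x :: w) ++ v) = avoids T24 (u ++ a :: v).
Proof.
move=> lt_uv lt_w w_dec.
have lt_ax : a < x by apply/lt_w/mem_head.
have marker y : y \in x :: w -> avoids T24 (u ++ y :: v) = avoids T24 (u ++ a :: v).
  move=> /lt_w lt_y; apply: avoids_map_marker => // z /lt_uv ?; lia.
apply/idP/idP => [|uav].
  rewrite -(marker x) ?mem_head //; apply: avoids_subseq.
  by rewrite cat_subseq //= eqxx suffix_subseq.
have {}lt_uv y z : y \in x :: w -> z \in u ++ v -> z < y.
  by move=> /lt_w ? /lt_uv ?; lia.
have free y b c d e : y \in x :: w -> subseq [:: b; c; d; e] (u ++ y :: v) ->
    [&& ~~ ((b < e < c) && (c < d)), ~~ ((c < b < d) && (d < e))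
      & ~~ ((d < b < e) && (e < c))].
  by move=> /marker; rewrite uav => /avoids_T24P; apply.
apply/avoids_T24P=> b c d e.
case/subseq_catP=> s1 [s23 [+ s1_u /subseq_catP[s2 [s3 [def_s23 s2_w s3_v]]]]].
rewrite {s23}def_s23 => def_s.
have gtn_trans : transitive gtn by move=> ? ? ?; rewrite /=; lia.
have s2_dec := subseq_sorted gtn_trans s2_w w_dec.
have lt_s2 : all (fun y => all (fun z => z < y) (s1 ++ s3)) s2.
  apply/allP=> y /(mem_subseq s2_w) y_w; apply/allP=> z z_s; apply: lt_uv => //.
  by move: z z_s; apply: mem_subseq; apply: cat_subseq.
case: s2 s2_w s2_dec lt_s2 def_s => [_ _ _|y [s2_w _ _|z s2 _ s2_dec lt_s2]] def_s.
- apply: (free x); rewrite ?mem_head // def_s /=.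
  by apply: cat_subseq s1_u (subseq_trans s3_v (subseq_cons _ _)).
- apply: (free y); rewrite ?(mem_subseq s2_w) ?mem_head // def_s /=.
  by apply: cat_subseq => //=; rewrite eqxx.
have : size s1 + size s2 + size s3 = 2.
  by have := congr1 size def_s; rewrite !size_cat /=; lia.
move: s2_dec lt_s2 def_s; clear.
by case: s1 => [|? [|? [|? s1]]] /=; case: s2 => [|? [|? [|? s2]]] /=;
  case: s3 => [|? [|? [|? s3]]] //= ? ? def_s ?;
  first [exfalso; lia | case: def_s => *; subst; lia].
Qed.

(** A 213 in [b] followed by [x] is a 2134, and [a] followed by a 231 in [b] is a 1342, which forces
    the condition on [b]. On the right-hand side [a] is reused as the marker N of the contracted
    block, being above [l1 ++ l2]. *)
Lemma avoids_T24_split a (b l1 l2 : seq nat) x w :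
    {in b, forall y, a < y} -> {in l1 ++ l2, forall y, y < a} ->
    {in b & x :: w, forall y z, y < z} -> {in x :: w, forall y, a < y} ->
    sorted gtn (x :: w) ->
  avoids T24 (a :: b ++ l1 ++ (x :: w) ++ l2) =
    avoids Q24 b && avoids T24 (l1 ++ a :: l2).
Proof.
move=> lt_ab lt_la lt_bw lt_aw w_dec; rewrite -(avoids_T24_inflate lt_la lt_aw) //.
set r := l1 ++ _.
have sub_wr : subseq (x :: w) r.
  exact: subseq_trans (prefix_subseq _ _) (suffix_subseq _ _).
apply/idP/andP => [w_av|[b_av r_av]].
  split; last first.
    by apply: avoids_subseq w_av; rewrite -cat_cons suffix_subseq.
  apply/avoids_Q24P => i j k Hb.
  have [/lt_ab ? /lt_ab ? /lt_ab ?] := mem_subseq3 Hb.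
  have /(lt_bw _ _)/(_ (mem_head x w)) ? : k \in b.
    by have [] := mem_subseq3 Hb.
  move/avoids_T24P: w_av => w_av.
  have /w_av/and3P[_ ? _] : subseq [:: i; j; k; x] (a :: b ++ r).
    apply: subseq_trans (subseq_cons _ _).
    rewrite -[[:: i; j; k; x]]/([:: i; j; k] ++ [:: x]) cat_subseq //.
    by rewrite sub1seq (mem_subseq sub_wr) ?mem_head.
  have /w_av/and3P[? _ _] : subseq [:: a; i; j; k] (a :: b ++ r).
    by rewrite /= eqxx; apply: subseq_trans Hb (prefix_subseq _ _).
  lia.
have big_r s : subseq s r -> all (leq a) s -> subseq s (x :: w).
  have <- : filter (leq a) r = x :: w.
    have no_big l : {subset l <= l1 ++ l2} -> filter (leq a) l = [::].
      move=> sub_l; apply/eqP; rewrite -[_ == _]negbK -has_filter; apply/hasPn.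
      by move=> y /sub_l/lt_la ?; lia.
    rewrite !filter_cat (no_big l1) ?(no_big l2) ?cats0 => [|y y_l|y y_l];
      rewrite ?mem_cat ?y_l ?orbT //.
    by apply/all_filterP/allP=> y /lt_aw; lia.
  by rewrite subseq_filter => -> ->.
have big1 y : y \in r -> a <= y -> y \in x :: w.
  by rewrite -!sub1seq => y_r le_ay; apply: big_r; rewrite //= le_ay.
have big2 y z : subseq [:: y; z] r -> a <= y -> a <= z -> z < y.
  move=> Hr le_ay le_az; move/sorted_gtnP: w_dec; apply.
  by apply: big_r; rewrite //= le_ay le_az.
(* In [r] the letters above [a] are contiguous; this excludes a 2413 whose 2 is in [a :: b] and
   whose 413 is in [r]. *)
have big_small_big y z t :
    subseq [:: y; z; t] r -> a <= y -> z < a -> a <= t -> False.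
  have l1a u : u \in l1 -> u < a by move=> u_l; apply: lt_la; rewrite mem_cat u_l.
  have l2a u : u \in l2 -> u < a.
    by move=> u_l; apply: lt_la; rewrite mem_cat u_l orbT.
  case/subseq3_catP => [|/l1a|/mem_subseq2[/l1a]|/mem_subseq3[/l1a]]; try lia.
  case/subseq3_catP => [|_ /mem_subseq2[_ /l2a]|_ /l2a|]; try lia.
    by move/mem_subseq3=> [/l2a]; lia.
  by move/mem_subseq3=> [_ /lt_aw]; lia.
have lt_ab_big y z : y \in a :: b -> z \in r -> a <= z -> y < z.
  rewrite inE => /predU1P[->|y_b] z_r /(big1 _ z_r); first exact: lt_aw.
  exact: lt_bw.
have ab_av : avoids T24 (a :: b) by rewrite avoids_T24_min // avoids_Q24_P24.
have ab_no213 y z t : subseq [:: y; z; t] (a :: b) -> ~~ (z < y < t).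
  case/subseq_consP=> [[-> /mem_subseq2[/lt_ab ? /lt_ab ?]]|Hb]; first lia.
  by move/avoids_Q24P: b_av => /(_ _ _ _ Hb)/andP[].
have ab_ge y : y \in a :: b -> a <= y.
  by rewrite inE => /predU1P[->|/lt_ab] //; lia.
rewrite -cat_cons; apply/avoids_T24P=> i j k l.
(* With one letter in [a :: b], 1342 and 2134 need an ascent among the letters of [r] above [a].
   With two or three, 1342 and 2413 need [l] strictly between [i] and [j], yet each letter of [r] is
   below or above all of [a :: b]; 2134 needs an ascent above [a] in [r], or a 213 in [a :: b]. *)
case/subseq4_catP=> [|i_ab Hr|Hab Hr|Hab l_r|]; try by apply/avoids_T24P.
- have [_ k_r _] := mem_subseq3 Hr.
  have := big2 _ _ (subseq_12 Hr); have := big2 _ _ (subseq_23 Hr).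
  have := big_small_big _ _ _ Hr; have := lt_ab_big _ _ i_ab k_r.
  have := ab_ge _ i_ab; lia.
- have [i_ab j_ab] := mem_subseq2 Hab; have [_ l_r] := mem_subseq2 Hr.
  have := big2 _ _ Hr; have := lt_ab_big _ _ j_ab l_r.
  have := ab_ge _ i_ab; lia.
have [i_ab j_ab k_ab] := mem_subseq3 Hab.
have := lt_ab_big _ _ i_ab l_r; have := lt_ab_big _ _ j_ab l_r.
have := lt_ab_big _ _ k_ab l_r; have := ab_no213 _ _ _ Hab.
have := ab_ge _ i_ab; have := ab_ge _ j_ab; lia.
Qed.

(** * The shape of an avoider, read from its first letter *)

Lemma spanP (p : pred nat) (s : seq nat) :
  exists s1 s2 : seq nat,
    [/\ s = s1 ++ s2, all p s1 & if s2 is x :: _ then ~~ p x else true].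
Proof.
elim: s => [|x s [s1 [s2 [-> s1_p s2_p]]]]; first by exists [::], [::].
case: (boolP (p x)) => px; first by exists (x :: s1), s2; rewrite /= px.
by exists [::], (x :: s1 ++ s2).
Qed.

(** The blocks are the successive maximal runs above and below [a]. Let [s] be the first letter of
    [l1]. An ascent y z in the block gives the 2134 a s y z, and a letter y of [b] above a letter z
    of the block gives the 2413 a y s z. *)
Lemma avoids_T24_shape (a : nat) (t : seq nat) :
    uniq (a :: t) -> avoids T24 (a :: t) ->
  exists b r : seq nat, [/\ t = b ++ r, {in b, forall y, a < y} &
    {in r, forall y, y < a} \/
    exists (l1 : seq nat) (x : nat) (w l2 : seq nat),
      [/\ r = l1 ++ (x :: w) ++ l2, l1 != [::], {in l1 ++ l2, forall y, y < a},
          {in x :: w, forall y, a < y} &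
          {in b & x :: w, forall y z, y < z} /\ sorted gtn (x :: w)]].
Proof.
move=> at_uniq /avoids_T24P at_av.
have [b [r [def_t /allP lt_ab r_hd]]] := spanP (fun y => a < y) t.
have a_nt : a \notin t by case/andP: at_uniq.
have neq_a y : y \in t -> y != a by move=> y_t; apply: contraNneq a_nt => <-.
have free y z u : subseq [:: y; z; u] t ->
   [&& ~~ ((a < u < y) && (y < z)), ~~ ((y < a < z) && (z < u))
     & ~~ ((z < a < u) && (u < y))].
  by move=> Ht; apply: at_av; rewrite /= eqxx.
exists b, r; split=> //.
have [l1 [r1 [def_r /allP lt_l1a r1_hd]]] := spanP (fun y => y < a) r.
case: r1 => [|x r1] in def_r r1_hd *.
  by left=> y; rewrite def_r cats0; apply: lt_l1a.
have [w [l2 [def_r1 /allP lt_aw l2_hd]]] := spanP (fun y => a < y) r1.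
right; exists l1, x, w, l2.
have lt_ax : a < x.
  have : x != a by apply: neq_a; rewrite def_t def_r !mem_cat mem_head !orbT.
  lia.
have l1_n0 : l1 != [::].
  by apply/eqP=> l1_0; move: r_hd; rewrite def_r l1_0 /= lt_ax.
case: l1 l1_n0 lt_l1a def_r => // s l1 _ lt_l1a def_r.
have lt_sa : s < a by apply: lt_l1a; apply: mem_head.
have lt_axw : {in x :: w, forall y, a < y}.
  by move=> y; rewrite inE => /predU1P[->|/lt_aw].
have {}def_t : t = b ++ (s :: l1) ++ (x :: w) ++ l2.
  by rewrite def_t def_r def_r1.
have t_uniq : uniq t by case/andP: at_uniq.
have sub_sw y z : subseq [:: y; z] ((x :: w) ++ l2) -> subseq [:: s; y; z] t.
  move=> Hw; rewrite def_t; apply: subseq_trans (suffix_subseq _ _).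
  by rewrite cat_cons /= eqxx; apply: subseq_trans Hw (suffix_subseq _ _).
have neq2 y z u : subseq [:: y; z; u] t -> [&& y != z, y != u & z != u].
  by move/subseq_uniq/(_ t_uniq); rewrite /= !inE negb_or !andbT -andbA.
split=> //; first by rewrite def_r def_r1.
  move=> y; rewrite mem_cat => /orP[/lt_l1a //|y_l2].
  have : y != a by apply: neq_a; rewrite def_t !mem_cat y_l2 !orbT.
  case: l2 l2_hd y_l2 def_t sub_sw {def_r1} => // h l2 lt_ha.
  rewrite inE => /predU1P[->|y_l2] def_t sub_sw y_a; first lia.
  have h_a : h != a by apply: neq_a; rewrite def_t !mem_cat mem_head !orbT.
  (* A letter [y] of [l2] above [a] is impossible: if it exceeds [x], then a s x y is a 2134;
     otherwise a x h y is a 2413. *)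
  have Hxhy : subseq [:: x; h; y] t.
    rewrite def_t; apply: subseq_trans (suffix_subseq _ _).
    apply: subseq_trans (suffix_subseq _ _).
    rewrite -[[:: x; h; y]]/([:: x] ++ [:: h; y]); apply: cat_subseq.
      by rewrite sub1seq mem_head.
    by rewrite /= eqxx sub1seq.
  have Hsxy : subseq [:: s; x; y] t.
    apply: sub_sw; rewrite -[[:: x; y]]/([:: x] ++ [:: y]).
    by apply: cat_subseq; rewrite sub1seq ?mem_head // inE y_l2 orbT.
  have := free _ _ _ Hxhy; have := free _ _ _ Hsxy; have := neq2 _ _ _ Hxhy; lia.
split=> [y z y_b z_w|].
  have Hysz : subseq [:: y; s; z] t.
    rewrite def_t -[[:: y; s; z]]/([:: y] ++ [:: s] ++ [:: z]).
    rewrite !cat_subseq ?sub1seq ?mem_head //.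
    by rewrite mem_cat z_w.
  have := free _ _ _ Hysz; have := neq2 _ _ _ Hysz; have := lt_axw _ z_w; lia.
apply/sorted_gtnP=> y z Hw.
have Hsyz : subseq [:: s; y; z] t.
  by apply: sub_sw; apply: subseq_trans Hw (prefix_subseq _ _).
have [y_w _] := mem_subseq2 Hw.
have := free _ _ _ Hsyz; have := neq2 _ _ _ Hsyz; have := lt_axw _ y_w; lia.
Qed.

(** A letter above [c] followed by one below [c] would form a 231 with [c]. *)
Lemma avoids_P24_shape (c : nat) (t : seq nat) :
    uniq (c :: t) -> avoids P24 (c :: t) ->
  exists u v : seq nat,
    [/\ t = u ++ v, {in u, forall x, x < c} & {in v, forall x, c < x}].
Proof.
move=> /andP[c_nt _] /avoids_P24P[no231 _].
have [u [v [def_t /allP lt_uc v_hd]]] := spanP (fun x => x < c) t.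
have neq_c x : x \in t -> x != c by move=> x_t; apply: contraNneq c_nt => <-.
exists u, v; split=> // y y_v.
have : y != c by apply: neq_c; rewrite def_t mem_cat y_v orbT.
case: v => // x v in v_hd def_t y_v *.
have : x != c by apply: neq_c; rewrite def_t mem_cat mem_head orbT.
case/predU1P: y_v => [->|y_v]; first lia.
have := no231 c x y; rewrite def_t /= eqxx => /(_ _); move: v_hd.
have -> : subseq [:: x; y] (u ++ x :: v).
  by apply: subseq_trans (suffix_subseq _ _); rewrite /= eqxx sub1seq.
by move=> ? /(_ isT); lia.
Qed.

(** After the split for 231, a letter below and a letter above [c] would form a 213 with [c]. *)
Lemma avoids_Q24_shape (c : nat) (t : seq nat) :
    uniq (c :: t) -> avoids Q24 (c :: t) ->
  {in t, forall x, x < c} \/ {in t, forall x, c < x}.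
Proof.
move=> ct_uniq ct_av.
have [u [v [def_t lt_uc lt_cv]]] := avoids_P24_shape ct_uniq (avoids_Q24_P24 ct_av).
case: u => [|x u] in def_t lt_uc *; first by right; rewrite def_t.
case: v => [|y v] in def_t lt_cv *; first by left; rewrite def_t cats0.
move/avoids_Q24P: ct_av => /(_ c x y); rewrite def_t /= !eqxx sub1seq.
rewrite mem_cat mem_head orbT => /(_ isT).
by have := lt_uc _ (mem_head _ _); have := lt_cv _ (mem_head _ _); lia.
Qed.

(** * Cutting an interval of letters, and counting by first letter *)

Lemma flatten_uniq_key (K S : eqType) (s : seq K) (F : K -> seq S) (key : S -> K) :
    uniq s -> {in s, forall x, uniq (F x)} ->
    {in s, forall x, {in F x, forall y, key y = x}} ->
  uniq (flatten (map F s)).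
Proof.
elim: s => //= x s IHs /andP[x_ns s_uniq] F_uniq F_key.
rewrite cat_uniq F_uniq ?mem_head // IHs // => [|y y_s|y y_s]; last first.
- by apply: F_key; rewrite inE y_s orbT.
- by apply: F_uniq; rewrite inE y_s orbT.
rewrite andbT; apply/hasPn=> w /flatten_mapP[y y_s w_y]; apply/negP=> w_x.
rewrite -(F_key x _ w w_x) ?mem_head // (F_key y _ w w_y) ?y_s // in x_ns.
by rewrite inE y_s orbT.
Qed.

(** Sorting [u] and [v] separately yields a sorted word, which must be the interval itself; it is
    then cut at [size u]. *)
Lemma perm_iota_cat (u v : seq nat) lo n :
    perm_eq (u ++ v) (iota lo n) -> {in u & v, forall x y, x < y} ->
  [/\ n = size u + size v, perm_eq u (iota lo (size u))
    & perm_eq v (iota (lo + size u) (size v))].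
Proof.
move=> uv_perm lt_uv.
have def_n : n = size u + size v.
  by rewrite -size_cat (perm_size uv_perm) size_iota.
have sort_uv : sort leq u ++ sort leq v = iota lo n.
  apply: (sorted_eq leq_trans anti_leq).
  - rewrite (sorted_pairwise leq_trans) pairwise_cat -!(sorted_pairwise leq_trans).
    rewrite !(sort_sorted leq_total) !andbT.
    apply/allrelP=> x y; rewrite !mem_sort => x_u y_v.
    exact/ltnW/lt_uv.
  - exact: iota_sorted.
  by apply: perm_trans uv_perm; apply: perm_cat; rewrite perm_sort.
move/eqP: sort_uv; rewrite def_n iotaD eqseq_cat ?size_sort ?size_iota //.
by case/andP=> /eqP <- /eqP <-; split=> //; rewrite perm_sym perm_sort.
Qed.

Lemma perm_iota_rev (v : seq nat) lo n :
  perm_eq v (iota lo n) -> sorted gtn v -> v = rev (iota lo n).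
Proof.
move=> v_perm v_dec; apply: (canRL revK); apply: (sorted_eq leq_trans anti_leq).
- rewrite rev_sorted; apply: sub_sorted v_dec => x y; exact: ltnW.
- exact: iota_sorted.
by rewrite perm_rev.
Qed.

Lemma rev_iota_sorted lo n : sorted gtn (rev (iota lo n)).
Proof. by rewrite rev_sorted iota_ltn_sorted. Qed.

Lemma perm_iota_mem (w : seq nat) lo n :
  perm_eq w (iota lo n) -> forall x, (x \in w) = (lo <= x < lo + n).
Proof. by move=> w_perm x; rewrite (perm_mem w_perm) mem_iota. Qed.

Lemma perm_iota_uniq (w : seq nat) lo n : perm_eq w (iota lo n) -> uniq w.
Proof. by move/perm_uniq->; apply: iota_uniq. Qed.

(** Once [c] is moved between [u] and [v] the three pieces are consecutive intervals, so [c] counts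
    the letters of [u]. *)
Lemma perm_iota_pivot (c : nat) (u v : seq nat) n :
    {in u, forall x, x < c} -> {in v, forall x, c < x} ->
  perm_eq (c :: u ++ v) (iota 0 n.+1) =
    [&& c == size u, size u + size v == n, perm_eq u (iota 0 (size u))
      & perm_eq v (iota c.+1 (size v))].
Proof.
move=> lt_uc lt_cv; rewrite -cat1s perm_catCA.
apply/idP/and4P => [uv_perm|[/eqP-> /eqP <- u_perm v_perm]].
  have [|def_n u_perm cv_perm] := perm_iota_cat uv_perm.
    by move=> x y /lt_uc ?; rewrite inE => /predU1P[->|/lt_cv]//; lia.
  have [|_ c_perm v_perm] := perm_iota_cat cv_perm.
    by move=> x y; rewrite inE => /eqP->; apply: lt_cv.
  have def_c : c = size u.
    by have := perm_iota_mem c_perm c; rewrite mem_head /=; lia.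
  split=> //; rewrite -?def_c //; first by move: def_n => /=; lia.
  by move: v_perm; rewrite -def_c addn1.
rewrite -addnS iotaD; apply: perm_cat => //=.
by rewrite perm_cons.
Qed.

Lemma num_avoiding0 T : all (fun tau => tau != [::]) T -> num_avoiding T 0 = 1.
Proof.
move=> T_n0; rewrite /num_avoiding /avoiding_words /= ifT //.
apply/allP=> tau /(allP T_n0) tau_n0; apply/containsP=> -[u].
rewrite subseq0 => /eqP-> /order_isoP[/esym/eqP]; rewrite size_eq0.
by rewrite (negPf tau_n0).
Qed.

(** [F c] lists the tails of the avoiders that start with [c]; the first letter serves as the key
    separating these lists. *)
Lemma num_avoiding_by_head T n (F : nat -> seq (seq nat)) :
    (forall c, c <= n -> uniq (F c)) ->
    (forall c t, c <= n ->
      (t \in F c) = perm_eq (c :: t) (iota 0 n.+1) && avoids T (c :: t)) ->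
  num_avoiding T n.+1 = \sum_(0 <= c < n.+1) size (F c).
Proof.
move=> F_uniq F_mem.
pose words := flatten [seq map (cons c) (F c) | c <- iota 0 n.+1].
have words_perm : perm_eq (avoiding_words T 0 n.+1) words.
  apply: uniq_perm; first exact: avoiding_words_uniq.
    apply: (flatten_uniq_key (key := head 0)) => [|c|c _ _ /mapP[t _ ->] //].
      exact: iota_uniq.
    rewrite mem_iota => c_n; rewrite map_inj_uniq ?F_uniq //.
    by move=> x y [].
  move=> w; rewrite mem_avoiding_words; apply/idP/flatten_mapP => [|[c]].
    case: w => [/andP[/perm_size//]|c t] w_av; exists c.
      by case/andP: w_av => /perm_mem <-; rewrite mem_head.
    apply: map_f; rewrite F_mem //.
    by case/andP: w_av => /perm_iota_mem/(_ c); rewrite mem_head.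
  rewrite mem_iota add0n ltnS => c_n /mapP[t]; rewrite F_mem // => ? ->.
  by [].
rewrite /num_avoiding (perm_size words_perm) size_flatten /shape -map_comp.
rewrite sumnE big_map /index_iota subn0; apply: eq_bigr => c _ /=.
by rewrite size_map.
Qed.

Lemma perm_iota_max n t : perm_eq (n :: t) (iota 0 n.+1) = perm_eq t (iota 0 n).
Proof. by rewrite -addn1 iotaD perm_sym perm_catC perm_cons perm_sym. Qed.

Lemma perm_iota_min n t : perm_eq (0 :: t) (iota 0 n.+1) = perm_eq t (iota 1 n).
Proof. by rewrite perm_cons. Qed.

(** * Counting the avoiders of {213, 231} and of {231, 2134} *)

(** The first letter must be extreme. The disjunction counts it once when [n] is 0, where smallest
    and largest coincide. *)
Lemma num_avoiding_Q24_rec n :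
  num_avoiding Q24 n.+1 =
    \sum_(0 <= c < n.+1) (if (c == 0) || (c == n) then num_avoiding Q24 n else 0).
Proof.
pose F c := if c == 0 then avoiding_words Q24 1 n
            else if c == n then avoiding_words Q24 0 n else [::].
rewrite (num_avoiding_by_head (F := F)) => [|c _|c t c_n]; rewrite /F.
- by apply: eq_bigr => c _; do 2?case: eqP => _; rewrite ?size_avoiding_words.
- by case: eqP => _; last case: eqP => _; rewrite ?avoiding_words_uniq.
have [->|c_n0] := eqVneq c 0.
  rewrite mem_avoiding_words perm_iota_min; apply: andb_id2l => t_perm.
  by rewrite avoids_Q24_min // => x; rewrite (perm_iota_mem t_perm); lia.
have [->|c_nn] := eqVneq c n.
  rewrite mem_avoiding_words perm_iota_max; apply: andb_id2l => t_perm.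
  by rewrite avoids_Q24_max // => x; rewrite (perm_iota_mem t_perm); lia.
apply/esym/andP=> -[ct_perm /(avoids_Q24_shape (perm_iota_uniq ct_perm))].
case=> [lt_tc|lt_ct]; move: ct_perm.
  by rewrite -[t]cats0 perm_iota_pivot //= addn0 => /and3P[]; lia.
rewrite -[t]cat0s perm_iota_pivot //= => /and3P[]; lia.
Qed.

Lemma num_avoiding_Q24 n : num_avoiding Q24 n.+1 = 2 ^ n.
Proof.
elim: n => [|n IHn]; rewrite num_avoiding_Q24_rec.
  by rewrite big_nat1 num_avoiding0.
rewrite big_nat_recl // big_nat_recr //= eqxx IHn big_nat big1 => [|c /andP[_ c_n]].
  by rewrite add0n addnn expnS mul2n.
by rewrite eqSS ltn_eqF.
Qed.

(** This counts the pairs (B0, B1) on [n.+1] letters: B0 has size at most [n], and B1 is the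
    remaining letters in decreasing order. *)
Lemma sum_num_avoiding_Q24 n :
  \sum_(0 <= m < n.+1) num_avoiding Q24 m = 2 ^ n.
Proof.
elim: n => [|n IHn]; first by rewrite big_nat1 num_avoiding0.
by rewrite big_nat_recr // IHn /= num_avoiding_Q24 addnn expnS mul2n.
Qed.

(** For an intermediate first letter [c] the letters above it form a forced decreasing suffix, so
    only the [Q24]-avoiding block below [c] is free. *)
Lemma num_avoiding_P24_rec n :
  num_avoiding P24 n.+1 =
    \sum_(0 <= c < n.+1) (if (c == 0) || (c == n) then num_avoiding P24 n
                          else num_avoiding Q24 c).
Proof.
pose F c := if c == 0 then avoiding_words P24 1 n
            else if c == n then avoiding_words P24 0 n
            else [seq u ++ rev (iota c.+1 (n - c)) | u <- avoiding_words Q24 0 c].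
rewrite (num_avoiding_by_head (F := F)) => [|c _|c t c_n]; rewrite /F.
- apply: eq_bigr => c _.
  by case: eqP => _; last case: eqP => _; rewrite ?size_map ?size_avoiding_words.
- case: eqP => _; last case: eqP => _; rewrite ?avoiding_words_uniq //.
  rewrite map_inj_in_uniq ?avoiding_words_uniq // => u v _ _ /eqP.
  rewrite -(inj_eq (can_inj revK)) !rev_cat eqseq_cat // eqxx.
  by move/eqP/(can_inj revK).
have [->|c_n0] := eqVneq c 0.
  rewrite mem_avoiding_words perm_iota_min; apply: andb_id2l => t_perm.
  by rewrite avoids_P24_min // => x; rewrite (perm_iota_mem t_perm); lia.
have [->|c_nn] := eqVneq c n.
  rewrite mem_avoiding_words perm_iota_max; apply: andb_id2l => t_perm.
  by rewrite avoids_P24_max // => x; rewrite (perm_iota_mem t_perm); lia.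
apply/mapP/andP => [[u]|[ct_perm ct_av]].
  rewrite mem_avoiding_words => /andP[u_perm u_av] ->.
  have sz_u : size u = c by rewrite (perm_size u_perm) size_iota.
  have lt_uc : {in u, forall x, x < c} by move=> x; rewrite (perm_iota_mem u_perm).
  have lt_cv : {in rev (iota c.+1 (n - c)), forall x, c < x}.
    by move=> x; rewrite mem_rev mem_iota; lia.
  rewrite perm_iota_pivot // sz_u eqxx size_rev size_iota subnKC // eqxx u_perm.
  rewrite perm_rev perm_refl avoids_P24_split ?u_av ?rev_iota_sorted //.
  - by rewrite rev_uniq iota_uniq.
  - by rewrite -size_eq0 sz_u.
  by rewrite -size_eq0 size_rev size_iota; lia.
have [u [v [def_t lt_uc lt_cv]]] := avoids_P24_shape (perm_iota_uniq ct_perm) ct_av.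
have := ct_perm; rewrite def_t perm_iota_pivot //.
case/and4P=> /eqP sz_u /eqP sz_v u_perm v_perm.
move: ct_av; rewrite def_t avoids_P24_split ?(perm_iota_uniq v_perm) //; last first.
- by apply/eqP=> v0; move: sz_u sz_v; rewrite v0 /=; lia.
- by apply/eqP=> u0; move: sz_u; rewrite u0 /=; lia.
case/andP=> u_av v_dec; exists u; first by rewrite mem_avoiding_words sz_u u_perm.
by congr (_ ++ _); rewrite (perm_iota_rev v_perm) //; congr (rev (iota _ _)); lia.
Qed.

(** The intermediate first letters contribute the [Q24] counts of sizes 1 to [n], which is [2 ^ n]
    less the term of size 0; the [+ 1] avoids a subtraction. *)
Lemma num_avoiding_P24 n :
  num_avoiding P24 n.+2 + 1 = (num_avoiding P24 n.+1).*2 + 2 ^ n.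
Proof.
rewrite num_avoiding_P24_rec big_nat_recl // big_nat_recr //= eqxx.
rewrite -(sum_num_avoiding_Q24 n) big_nat_recl // num_avoiding0 //.
rewrite (eq_big_nat _ _ (F2 := fun c => num_avoiding Q24 c.+1)) => [|c /andP[_ c_n]].
  by lia.
by rewrite eqSS ltn_eqF.
Qed.

(** * Counting the avoiders of {1342, 2134, 2413} *)

(** These are the contracted words L' N L'' with L' nonempty; the maximum [c] plays N. *)
Definition nonmax_head_words c :=
  [seq s <- avoiding_words T24 0 c.+1 | head 0 s != c].

(** Deleting a leading maximum is a bijection onto the avoiders of size [c], since that letter lies
    above everything after it. *)
Lemma size_nonmax_head_words c :
  size (nonmax_head_words c) + num_avoiding T24 c = num_avoiding T24 c.+1.
Proof.
rewrite /nonmax_head_words size_filter.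
have -> : num_avoiding T24 c =
    count (fun s => head 0 s == c) (avoiding_words T24 0 c.+1).
  rewrite -size_filter /num_avoiding -(size_map (cons c)).
  symmetry; apply/perm_size/uniq_perm.
  - exact/filter_uniq/avoiding_words_uniq.
  - by rewrite map_inj_uniq ?avoiding_words_uniq // => x y [].
  have max_mem t :
      (c :: t \in avoiding_words T24 0 c.+1) = (t \in avoiding_words T24 0 c).
    rewrite !mem_avoiding_words perm_iota_max; apply: andb_id2l => t_perm.
    have av1 : avoids T24 [:: c] by apply/avoids_T24P => i j k l /size_subseq.
    rewrite -[c :: t]cat1s avoids_T24_skew ?av1 // => x y; rewrite inE => /eqP->.
    by rewrite (perm_iota_mem t_perm).
  move=> s; rewrite mem_filter; apply/andP/mapP => [[]|[t t_av ->]]; last first.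
    by rewrite /= eqxx max_mem.
  case: s => [_|x t /eqP /= ->]; last by rewrite max_mem; exists t.
  by rewrite mem_avoiding_words => /andP[/perm_size].
by rewrite addnC -[RHS](count_predC (fun s => head 0 s == c)).
Qed.

(** Undoes the contraction: the marker [c] is replaced by the block [w]. *)
Definition expand (c : nat) (w s : seq nat) : seq nat :=
  take (index c s) s ++ w ++ drop (index c s).+1 s.

Lemma expandE (c : nat) w l1 l2 :
  {in l1 ++ l2, forall x, x < c} -> expand c w (l1 ++ c :: l2) = l1 ++ w ++ l2.
Proof.
move=> lt_lc; have c_nl : c \notin l1.
  by apply/negP=> c_l; have := lt_lc c; rewrite mem_cat c_l ltnn => /(_ isT).
rewrite /expand index_cat (negPf c_nl) /= eqxx addn0 take_size_cat //.
by rewrite -cat_rcons drop_size_cat // size_rcons.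
Qed.

Lemma nonmax_head_wordsP c s :
  reflect (exists l1 l2, [/\ s = l1 ++ c :: l2, l1 != [::],
             {in l1 ++ l2, forall x, x < c}, perm_eq (l1 ++ l2) (iota 0 c)
             & avoids T24 s])
          (s \in nonmax_head_words c).
Proof.
rewrite mem_filter mem_avoiding_words.
apply: (iffP and3P) => [[s_hd s_perm s_av]|[l1 [l2 [-> l1_n0 lt_lc l_perm s_av]]]].
  have c_s : c \in s by rewrite (perm_iota_mem s_perm) /=.
  case/splitPr: c_s s_hd s_perm s_av => l1 l2 s_hd s_perm s_av.
  have l_perm : perm_eq (l1 ++ l2) (iota 0 c).
    by rewrite -perm_iota_max -cat1s perm_catCA.
  exists l1, l2; split=> // [|x]; last by rewrite (perm_iota_mem l_perm).
  by apply: contraNneq s_hd => ->; rewrite /= eqxx.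
split=> //; last by rewrite -cat1s perm_catCA /= perm_iota_max.
by case: l1 l1_n0 lt_lc {l_perm s_av} => //= x l1 _ /(_ x (mem_head _ _)) ?; lia.
Qed.

(** The first letter above [c] shows where the block starts, hence where the marker stood. *)
Lemma expand_inj c w :
  w != [::] -> {in w, forall x, c < x} ->
  {in nonmax_head_words c &, injective (expand c w)}.
Proof.
move=> w_n0 lt_cw s s' /nonmax_head_wordsP[l1 [l2 [-> _ lt_l _ _]]].
case/nonmax_head_wordsP=> k1 [k2 [-> _ lt_k _ _]]; rewrite !expandE //.
have find_big u v : {in u ++ v, forall x, x < c} ->
    find (leq c.+1) (u ++ w ++ v) = size u.
  move=> lt_uv; rewrite find_cat ifN.
    by case: w w_n0 lt_cw => // x w _ lt_cw; rewrite /= lt_cw ?mem_head ?addn0.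
  by apply/hasPn=> x x_u; have := lt_uv x; rewrite mem_cat x_u => /(_ isT); lia.
move=> eq_lk; have := find_big _ _ lt_k; rewrite -eq_lk find_big // => sz1.
move/eqP: eq_lk; rewrite !eqseq_cat // => /and3P[/eqP-> _ /eqP->] //.
Qed.

(* The words t such that c t is an avoider whose block B0 has size m; the case
   m = n - c is the one where there is no letter above c after B0. *)
Definition T24_tails n c m : seq (seq nat) :=
  if m == n - c then
    [seq b ++ l | b <- avoiding_words P24 c.+1 m, l <- avoiding_words T24 0 c]
  else
    [seq b ++ expand c (rev (iota (c.+1 + m) (n - c - m))) s
      | b <- avoiding_words Q24 c.+1 m, s <- nonmax_head_words c].

(** Recovers the size of B0 from a tail, as the key separating the lists [T24_tails n c m]. An empty
    [r] is covered because [find] then returns the length of the word. *)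
Lemma find_small (c : nat) b r :
    {in b, forall x, c < x} -> (if r is x :: _ then x < c else true) ->
  find (fun x => x < c) (b ++ r) = size b.
Proof.
move=> lt_cb r_hd; rewrite find_cat ifN.
  by case: r r_hd => [|x r /= ->]; rewrite addn0.
by apply/hasPn=> x /lt_cb; lia.
Qed.

Lemma T24_tails_sound n c m t :
    c <= n -> m <= n - c -> t \in T24_tails n c m ->
  [/\ perm_eq (c :: t) (iota 0 n.+1), avoids T24 (c :: t)
    & find (fun x => x < c) t = m].
Proof.
move=> c_n m_nc; rewrite /T24_tails.
have lt_b b : perm_eq b (iota c.+1 m) -> {in b, forall x, c < x}.
  by move=> b_perm x; rewrite (perm_iota_mem b_perm); case/andP.
have [def_m|m_n] := eqVneq m (n - c).
  case/allpairsP=> -[b l] /= [+ + ->]; rewrite !mem_avoiding_words.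
  case/andP=> b_perm b_av /andP[l_perm l_av].
  have lt_cb := lt_b b b_perm.
  have lt_lc : {in l, forall x, x < c} by move=> x; rewrite (perm_iota_mem l_perm).
  have sz_b : size b = m by rewrite (perm_size b_perm) size_iota.
  have sz_l : size l = c by rewrite (perm_size l_perm) size_iota.
  split.
  (* [perm_iota_pivot] takes the letters below [c] first, whereas in the word they come last. *)
  - have -> : perm_eq (c :: b ++ l) =1 perm_eq (c :: l ++ b).
      by apply/permPl; rewrite perm_cons perm_catC.
    by rewrite perm_iota_pivot // sz_b sz_l l_perm b_perm eqxx /= andbT; lia.
  - rewrite -cat_cons avoids_T24_skew ?l_av ?avoids_T24_min ?b_av // => x y.
    by rewrite inE => /predU1P[->|/lt_cb ?] /lt_lc ?; lia.
  rewrite find_small //; case: l lt_lc {l_perm l_av sz_l} => // x l; apply.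
  exact: mem_head.
case/allpairsP=> -[b s] /= [+ + ->]; rewrite mem_avoiding_words.
case/andP=> b_perm b_av /nonmax_head_wordsP[l1 [l2 [def_s l1_n0 lt_lc l_perm s_av]]].
rewrite {s}def_s in s_av *.
rewrite expandE //; set w := rev _.
have w_perm : perm_eq w (iota (c.+1 + m) (n - c - m)) by rewrite perm_rev.
have lt_cb := lt_b b b_perm.
have lt_cw : {in w, forall x, c < x}.
  by move=> x; rewrite (perm_iota_mem w_perm); lia.
have sz_b : size b = m by rewrite (perm_size b_perm) size_iota.
have sz_l : size (l1 ++ l2) = c by rewrite (perm_size l_perm) size_iota.
have sz_w : size w = n - c - m by rewrite (perm_size w_perm) size_iota.
split.
- have -> : perm_eq (c :: b ++ l1 ++ w ++ l2) =1 perm_eq (c :: (l1 ++ l2) ++ b ++ w).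
    by apply/permPl/seq.permP=> p; rewrite /= !count_cat; lia.
  rewrite perm_iota_pivot //; last first.
    by move=> x; rewrite mem_cat => /orP[/lt_cb|/lt_cw].
  by rewrite sz_l l_perm eqxx size_cat sz_b sz_w iotaD perm_cat //=; lia.
- have w_dec : sorted gtn w by rewrite rev_iota_sorted.
  case def_w: w => [|x w'] in lt_cw w_dec w_perm sz_w *.
    by move: sz_w => /=; lia.
  rewrite avoids_T24_split ?b_av // => y z.
  by rewrite (perm_iota_mem b_perm) (perm_iota_mem w_perm); lia.
rewrite find_small //; case: l1 l1_n0 lt_lc {l_perm s_av sz_l} => // x l _; apply.
exact: mem_head.
Qed.

Lemma T24_tails_complete n c t (m := find (fun x => x < c) t) :
    perm_eq (c :: t) (iota 0 n.+1) -> avoids T24 (c :: t) ->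
  m <= n - c /\ t \in T24_tails n c m.
Proof.
move=> ct_perm ct_av.
have [b [r [def_t lt_cb shape]]] := avoids_T24_shape (perm_iota_uniq ct_perm) ct_av.
case: shape => [lt_rc|[l1 [x [w [l2 [def_r l1_n0 lt_lc lt_cw [lt_bw w_dec]]]]]]].
  have def_m : m = size b.
    rewrite /m def_t find_small //; case: r lt_rc {def_t} => // x r; apply.
    exact: mem_head.
  have : perm_eq (c :: r ++ b) (iota 0 n.+1).
    by apply: perm_trans ct_perm; rewrite def_t perm_cons perm_catC.
  rewrite perm_iota_pivot // => /and4P[/eqP sz_r /eqP sz_b r_perm b_perm].
  have m_nc : m = n - c by lia.
  move: ct_av; rewrite def_t -cat_cons avoids_T24_skew; last first.
    by move=> y z; rewrite inE => /predU1P[->|/lt_cb ?] /lt_rc ?; lia.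
  rewrite avoids_T24_min // => /andP[b_av r_av].
  split; first by rewrite m_nc.
  rewrite /T24_tails m_nc eqxx -m_nc; apply/allpairsP; exists (b, r).
  by rewrite /= !mem_avoiding_words def_m b_perm b_av {1}sz_r r_perm.
have def_m : m = size b.
  rewrite /m def_t def_r find_small //.
  case: l1 l1_n0 lt_lc {def_r} => // y l _; apply.
  exact: mem_head.
have lt_cbw : {in b ++ x :: w, forall y, c < y}.
  by move=> y; rewrite mem_cat => /orP[/lt_cb|/lt_cw].
have : perm_eq (c :: (l1 ++ l2) ++ b ++ x :: w) (iota 0 n.+1).
  apply: perm_trans ct_perm; rewrite def_t def_r.
  by move: (x :: w) => v; apply/seq.permP=> p; rewrite /= !count_cat; lia.
rewrite perm_iota_pivot // => /and4P[/eqP sz_l /eqP sz_b l_perm bw_perm].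
have [_ b_perm w_perm] := perm_iota_cat bw_perm lt_bw.
move: sz_b; rewrite -sz_l size_cat /= => sz_b.
move: ct_av; rewrite def_t def_r avoids_T24_split // => /andP[b_av s_av].
(* The block [x :: w] is nonempty, which selects the second branch of [T24_tails]. *)
have lt_m : m < n - c by lia.
split; first exact: ltnW.
rewrite /T24_tails ifN ?ltn_eqF //.
apply/allpairsP; exists (b, l1 ++ c :: l2) => /=; split.
- by rewrite mem_avoiding_words def_m b_perm.
- by apply/nonmax_head_wordsP; exists l1, l2; rewrite -sz_l in l_perm.
rewrite expandE // -cat_cons; congr (_ ++ (_ ++ (_ ++ _))).
rewrite (perm_iota_rev w_perm) //.
by congr (rev (iota _ _)); rewrite /=; lia.
Qed.

(** The prefix of length [m] gives back [b]. In the second branch the block has [n - c - m > 0]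
    letters, so [expand_inj] gives back [s]. *)
Lemma T24_tails_uniq n c m : m <= n - c -> uniq (T24_tails n c m).
Proof.
move=> m_nc; rewrite /T24_tails; case: eqP => m_n; apply: allpairs_uniq;
  try exact: avoiding_words_uniq; try exact/filter_uniq/avoiding_words_uniq.
  move=> _ _ /allpairsP[[b l] [/= + _ ->]] /allpairsP[[b' l'] [/= + _ ->]] /=.
  rewrite !mem_avoiding_words => /andP[/perm_size + _] /andP[/perm_size + _].
  move=> sz_b sz_b' /eqP; rewrite eqseq_cat ?sz_b ?sz_b' //.
  by case/andP=> /eqP-> /eqP->.
move=> _ _ /allpairsP[[b s] [/= + s_in ->]] /allpairsP[[b' s'] [/= + s'_in ->]] /=.
rewrite !mem_avoiding_words => /andP[/perm_size sz_b _] /andP[/perm_size sz_b' _].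
move/eqP; rewrite eqseq_cat ?sz_b ?sz_b' // => /andP[/eqP-> /eqP/expand_inj->] //.
- by rewrite -size_eq0 size_rev size_iota; lia.
by move=> x; rewrite mem_rev mem_iota; lia.
Qed.

(** Here [c] is the first letter. The first product is the case [m = n - c]; in the second, the
    inner sum counts the pairs (B0, B1) and the difference counts the contracted words. *)
Lemma num_avoiding_T24_rec n :
  num_avoiding T24 n.+1 =
    \sum_(0 <= c < n.+1)
      (num_avoiding P24 (n - c) * num_avoiding T24 c
       + (\sum_(0 <= m < n - c) num_avoiding Q24 m)
         * (num_avoiding T24 c.+1 - num_avoiding T24 c)).
Proof.
pose F c := flatten [seq T24_tails n c m | m <- iota 0 (n - c).+1].
rewrite (num_avoiding_by_head (F := F)) => [|c c_n|c t c_n].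
- apply: eq_big_nat => c /andP[_ c_n].
  rewrite size_flatten /shape -map_comp sumnE big_map.
  have -> : iota 0 (n - c).+1 = index_iota 0 (n - c).+1.
    by rewrite /index_iota subn0.
  rewrite big_nat_recr //= addnC.
  rewrite /T24_tails eqxx size_allpairs !size_avoiding_words; congr (_ + _).
  rewrite big_distrl /=; apply: eq_big_nat => m m_nc.
  rewrite ifN; last by apply/eqP; lia.
  by rewrite size_allpairs size_avoiding_words -size_nonmax_head_words addnK.
- apply: (flatten_uniq_key (key := find (fun x => x < c))); rewrite ?iota_uniq //.
    by move=> m; rewrite mem_iota => ?; apply: T24_tails_uniq; lia.
  by move=> m; rewrite mem_iota => m_in t /T24_tails_sound[] //; lia.
apply/flatten_mapP/andP=> [[m]|[ct_perm ct_av]].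
  by rewrite mem_iota => m_in /T24_tails_sound[] //; lia.
have [m_nc t_in] := T24_tails_complete ct_perm ct_av.
by exists (find (fun x => x < c) t) => //; rewrite mem_iota; lia.
Qed.

(** * Generating functions, by congruences modulo powers of ['X] *)

Import GRing.Theory.
Local Open Scope ring_scope.

(** A series identity is stated as a divisibility by ['X^N] between truncations, for every [N], so
    that polynomial ring identities apply. *)
Definition fps_trunc (R : nzRingType) (N : nat) (f : fps R) : {poly R} :=
  \poly_(i < N) f i.

Lemma coef_fps_trunc (R : nzRingType) N (f : fps R) i :
  (i < N)%N -> (fps_trunc N f)`_i = f i.
Proof. by rewrite coef_poly => ->. Qed.

Lemma coefM_fps_trunc (R : nzRingType) N (p : {poly R}) (f : fps R) i :
  (i < N)%N -> (p * fps_trunc N f)`_i = fps_mul (fps_of_poly p) f i.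
Proof.
move=> i_N; rewrite coefM; apply: eq_bigr => j _; rewrite coef_fps_trunc //.
exact: leq_ltn_trans (leq_subr _ _) i_N.
Qed.

Lemma dvdp_Xn_coef (K : fieldType) N (p : {poly K}) :
  reflect (forall i, (i < N)%N -> p`_i = 0) ('X^N %| p).
Proof.
apply: (iffP idP) => [/dvdpP[q ->] i i_N|p0]; first by rewrite coefMXn i_N.
rewrite -(poly_take_drop N p) (_ : take_poly N p = 0) ?add0r ?dvdp_mull //.
by apply/polyP=> i; rewrite coef_take_poly coef0; case: ifP => // /p0.
Qed.

Lemma T24_series_combination (X F P U V : {poly rat}) (d : {poly rat}) :
    d %| (1 - 2%:R *: X) * U - X ->
    d %| (1 - X) * V - X ->
    d %| (1 - 2%:R *: X) * P - (1 - X) - X * (U - V) ->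
    d %| F - 1 - X * (P * F) - U * (F - 1 - X * F) ->
  d %| (1 - 7%:R *: X + 16%:R *: X ^+ 2 - 14%:R *: X ^+ 3 + 3%:R *: X ^+ 4) * F
       - (1 - X) * (1 - 2%:R *: X) * (1 - 3%:R *: X).
Proof.
rewrite !scaler_nat => U_eq V_eq P_eq F_eq.
set E := (E in d %| E).
(* The coefficients eliminate the unknowns: multiplying the relation for [F] by
   [(1 - X) * (1 - X *+ 2) ^+ 2] makes room to cancel [P] by its own relation, then [U] and [V] by
   theirs. *)
have -> : E =
      (1 - X) * (1 - X *+ 2) ^+ 2
        * (F - 1 - X * (P * F) - U * (F - 1 - X * F))
    + X * F * (1 - X) * (1 - X *+ 2)
        * ((1 - X *+ 2) * P - (1 - X) - X * (U - V))
    + ((1 - X) * (1 - X *+ 2) * (F - 1 - X * F) + X ^+ 2 * F * (1 - X))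
        * ((1 - X *+ 2) * U - X)
    - X ^+ 2 * F * (1 - X *+ 2) * ((1 - X) * V - X).
  by rewrite /E; ring.
by rewrite dvdp_sub ?dvdp_add ?dvdp_mull.
Qed.

(** With G the truncated inverse of [q], both q F - p and q G - 1 vanish modulo ['X^N], hence so
    does F - p G = G (q F - p) - F (q G - 1). *)
Lemma fps_divP (K : fieldType) (f : fps K) (p q : {poly K}) :
    q`_0 != 0 ->
    (forall N, 'X^N %| q * fps_trunc N f - p) ->
  f =1 fps_div (fps_of_poly p) (fps_of_poly q).
Proof.
move=> q0 f_eq n; rewrite /fps_div -(coefM_fps_trunc _ _ (ltnSn n)).
set g := fps_inv _; pose N := n.+1.
have g_eq : 'X^N %| q * fps_trunc N g - 1.
  apply/dvdp_Xn_coef=> i i_N; rewrite coefB coefM_fps_trunc // fps_mul_inv //.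
  exact: subrr.
pose F := fps_trunc N f; pose G := fps_trunc N g.
have : 'X^N %| F - p * G.
  have -> : F - p * G = G * (q * F - p) - F * (q * G - 1) by ring.
  by rewrite dvdp_sub ?dvdp_mull.
move/dvdp_Xn_coef/(_ n (ltnSn n))/eqP.
by rewrite coefB subr_eq0 coef_fps_trunc // => /eqP.
Qed.

(* The coefficients of x / (1 - x). *)
Definition ones (n : nat) : rat := (0 < n)%:R.

(* The coefficients of x / (1 - 2x). *)
Definition pow2 (n : nat) : rat := if n is m.+1 then (2 ^ m)%:R else 0.

Lemma coef_1subZX_mul (c : rat) (p : {poly rat}) i :
  ((1 - c *: 'X) * p)`_i = p`_i - c * (if i is j.+1 then p`_j else 0).
Proof.
rewrite mulrBl mul1r coefB -scalerAl coefZ coefXM; by case: i.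
Qed.

Lemma fps_pow2 N : 'X^N %| (1 - 2%:R *: 'X) * fps_trunc N pow2 - 'X.
Proof.
apply/dvdp_Xn_coef=> i i_N; rewrite coefB coef_1subZX_mul coefX coef_fps_trunc //.
case: i i_N => [|i] i_N; first by rewrite mulr0 !subr0.
rewrite coef_fps_trunc 1?ltnW //; case: i i_N => [|i] _ /=; first by ring.
by rewrite expnS natrM; ring.
Qed.

Lemma fps_ones N : 'X^N %| (1 - 'X) * fps_trunc N ones - 'X.
Proof.
have -> : 1 - 'X = 1 - 1 *: 'X :> {poly rat} by rewrite scale1r.
apply/dvdp_Xn_coef=> i i_N; rewrite coefB coef_1subZX_mul coefX coef_fps_trunc //.
case: i i_N => [|i] i_N; first by rewrite mulr0 !subr0.
rewrite coef_fps_trunc 1?ltnW // /ones.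
by case: i i_N => [|i] _ /=; rewrite mul1r ?subr0 subrr.
Qed.

Lemma fps_P24 N :
  'X^N %| (1 - 2%:R *: 'X) * fps_trunc N (avoid_gf P24) - (1 - 'X)
          - 'X * (fps_trunc N pow2 - fps_trunc N ones).
Proof.
apply/dvdp_Xn_coef=> i i_N; rewrite !coefB coef_1subZX_mul coefXM coef1 coefX.
rewrite /avoid_gf coef_fps_trunc // card_avoiders.
case: i i_N => [|i] i_N /=; first by rewrite num_avoiding0 //; ring.
have lt_iN := ltnW i_N; rewrite coefB !coef_fps_trunc // card_avoiders.
(* Degree 1 is checked directly, since [num_avoiding_P24] starts at size 2; from degree 2 on, the
   coefficient [2 ^ i - 1] of U - V matches that recurrence. *)
case: i i_N lt_iN => [|i] _ _ /=.
  by rewrite num_avoiding_P24_rec big_nat1 num_avoiding0 //; ring.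
have /(congr1 (fun m => m%:R : rat)) := num_avoiding_P24 i.
rewrite -muln2 !natrD natrM => /eqP; rewrite -subr_eq0 => /eqP P_eq.
rewrite /ones /=; rewrite -[RHS]P_eq; ring.
Qed.

Lemma sum_num_avoiding_Q24_pow2 n :
  (\sum_(0 <= m < n) num_avoiding Q24 m)%N%:R = pow2 n.
Proof. by case: n => [|n]; [rewrite big_geq | rewrite sum_num_avoiding_Q24]. Qed.

Lemma fps_T24 N :
  'X^N %| fps_trunc N (avoid_gf T24) - 1
          - 'X * (fps_trunc N (avoid_gf P24) * fps_trunc N (avoid_gf T24))
          - fps_trunc N pow2 * (fps_trunc N (avoid_gf T24) - 1
                                - 'X * fps_trunc N (avoid_gf T24)).
Proof.
set f := avoid_gf T24; set F := fps_trunc N f.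
set P := fps_trunc N _; set U := fps_trunc N pow2.
have fE n : f n = (num_avoiding T24 n)%:R by rewrite /f /avoid_gf card_avoiders.
have f0 : f 0%N = 1 by rewrite fE num_avoiding0.
(* The coefficients of F - 1 - x F. Replacing that polynomial by the truncation of [g] turns its
   product with U into a plain convolution. *)
pose g (n : nat) : rat := if n is m.+1 then f m.+1 - f m else 0.
have g_eq : 'X^N %| F - 1 - 'X * F - fps_trunc N g.
  apply/dvdp_Xn_coef=> i i_N; rewrite /F !coefB coefXM coef1.
  case: i i_N => [|i] i_N /=; rewrite !coef_fps_trunc ?(ltnW i_N) //=.
    by rewrite f0; ring.
  by ring.
have -> : F - 1 - 'X * (P * F) - U * (F - 1 - 'X * F) =
   (F - 1 - 'X * (P * F) - fps_trunc N g * U)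
   - U * (F - 1 - 'X * F - fps_trunc N g) by ring.
rewrite dvdp_sub ?dvdp_mull //; apply/dvdp_Xn_coef=> i i_N.
rewrite !coefB coefXM coef1 (coefM_fps_trunc (fps_trunc N g) pow2 i_N).
rewrite (coef_fps_trunc f i_N) /fps_mul big_ord_recl {1}/fps_of_poly.
(* The term of index 0 vanishes as [g 0] is 0; the shifted sum then matches [num_avoiding_T24_rec]
   term by term. *)
rewrite coef_fps_trunc ?(leq_ltn_trans _ i_N) // mul0r add0r.
case: i i_N => [|i] i_N /=; first by rewrite big_ord0 f0; ring.
have lt_iN := ltnW i_N; rewrite [P * _]mulrC coefM_fps_trunc // subr0.
rewrite fE num_avoiding_T24_rec big_mkord natr_sum -!sumrB big1 // => k _.
rewrite /fps_of_poly /bump /= add1n subSS !coef_fps_trunc ?(leq_trans _ i_N) //=.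
  rewrite natrD !natrM sum_num_avoiding_Q24_pow2 natrB.
    by rewrite !fE /avoid_gf card_avoiders; ring.
  (* The counts are nondecreasing, so the truncated subtraction in the recurrence is a true
     difference. *)
  by rewrite -size_nonmax_head_words leq_addl.
  by rewrite ltnS ltn_ord.
exact/leqW/ltn_ord.
Qed.

Theorem theorem24 :
  avoid_gf [:: [:: 1; 3; 4; 2]; [:: 2; 1; 3; 4]; [:: 2; 4; 1; 3]]%N
  =1 fps_div
       (fps_of_poly ((1 - 'X) * (1 - 2%:R *: 'X) * (1 - 3%:R *: 'X)))
       (fps_of_poly (1 - 7%:R *: 'X + 16%:R *: 'X^2 - 14%:R *: 'X^3
                     + 3%:R *: 'X^4)).
Proof.
apply: fps_divP => [|N].
  by rewrite !(coefD, coefN, coefZ, coefX, coefXn, coef1).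
exact: T24_series_combination (fps_pow2 N) (fps_ones N) (fps_P24 N) (fps_T24 N).
Qed.
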